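(* Let $G$ be a simple connected undirected graph of order $n\ge 2$ that is $r$-regular and $k$-resistance regular, and let $\rho_1(G)\ge\rho_2(G)\ge\cdots\ge\rho_n(G)$ be the eigenvalues, counted with multiplicity, of its resistance distance matrix. Then the eigenvalues, counted with multiplicity, of the resistance distance matrix of the double graph $D_2G$ are: $\frac{\rho_1(G)}{2}+\frac nr$ (once); $\frac{\rho_i(G)}{2}$ (once for each $i=2,\dots,n$); and $-\frac1r$ ($n$ times).
   Context: For a connected graph $G$ with vertices $v_1,\dots,v_n$, Laplacian matrix $L$ (degree matrix minus adjacency matrix) and Moore-Penrose inverse $L^\dagger=(l^\dagger_{ij})$, the resistance distance is $r_{ij}=l^\dagger_{ii}+l^\dagger_{jj}-2l^\dagger_{ij}$, and the resistance distance matrix is $R(G)=(r_{ij})$. $G$ is $k$-resistance regular if every row sum of $R(G)$ equals $k$; it is $r$-regular if every vertex has degree $r$. The double graph $D_2G$ of a graph $G$ with vertices $v_1,\dots,v_n$ is obtained by taking $G$ together with another copy of $G$ on vertices $v_1',\dots,v_n'$ ($v_i'$ corresponding to $v_i$) and joining, for each $i$, $v_i'$ to every vertex in the neighborhood $N(v_i)$ of $v_i$ in $G$. *)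

(* Defs.v *)
From mathcomp Require Import all_boot all_order all_algebra.

Set Implicit Arguments.
Unset Strict Implicit.
Unset Printing Implicit Defensive.

Import Order.TTheory GRing.Theory Num.Theory.
Local Open Scope ring_scope.

Section MoorePenrose.
Variable R : realFieldType.

(* The four Penrose equations; over a real field the adjoint is the
   transpose. *)
Definition is_mpinv m n (A : 'M[R]_(m, n)) (X : 'M[R]_(n, m)) : Prop :=
  [/\ A *m X *m A = A, X *m A *m X = X,
      (A *m X)^T = A *m X & (X *m A)^T = X *m A].

(* With the full-rank factorization A = C *m B, C = col_base A, B = row_base A,
   the Moore-Penrose inverse is B^T (B B^T)^-1 (C^T C)^-1 C^T.  Lemmas mpinvP
   and is_mpinv_uniq show that it is the unique solution of the Penrose
   equations. *)
Definition mpinv m n (A : 'M[R]_(m, n)) : 'M[R]_(n, m) :=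
  (row_base A)^T *m invmx (row_base A *m (row_base A)^T)
  *m (invmx ((col_base A)^T *m col_base A) *m (col_base A)^T).

Lemma mulmx_tr_eq0 n (u : 'rV[R]_n) : u *m u^T = 0 -> u = 0.
Proof.
move=> /matrixP/(_ 0 0); rewrite !mxE => /eqP.
under eq_bigr => i _ do rewrite mxE -expr2.
rewrite psumr_eq0 => [/allP h|i _]; last exact: sqr_ge0.
apply/rowP => i; rewrite mxE; apply/eqP.
by have := h i (mem_index_enum i); rewrite /= sqrf_eq0.
Qed.

Lemma row_free_gram_unit m n (B : 'M[R]_(m, n)) :
  row_free B -> B *m B^T \in unitmx.
Proof.
move=> fB; rewrite -row_free_unit -kermx_eq0; apply/eqP/row_matrixP => i.
rewrite row0; apply: (row_free_inj fB); rewrite mul0mx.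
apply: mulmx_tr_eq0; rewrite trmx_mul mulmxA -(mulmxA _ B).
by rewrite -row_mul mulmx_ker row0 mul0mx.
Qed.

Lemma full_rank_mpinv m n p (C : 'M[R]_(m, p)) (B : 'M[R]_(p, n)) :
  row_full C -> row_free B ->
  is_mpinv (C *m B)
    (B^T *m invmx (B *m B^T) *m (invmx (C^T *m C) *m C^T)).
Proof.
move=> fC fB; have uB := row_free_gram_unit fB.
have uC : C^T *m C \in unitmx.
  rewrite -{2}[C]trmxK; apply: row_free_gram_unit.
  by rewrite /row_free mxrank_tr.
have symB : (invmx (B *m B^T))^T = invmx (B *m B^T).
  by rewrite trmx_inv trmx_mul trmxK.
have symC : (invmx (C^T *m C))^T = invmx (C^T *m C).
  by rewrite trmx_inv trmx_mul trmxK.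
set P := invmx (B *m B^T) in symB *; set Q := invmx (C^T *m C) in symC *.
have AX : C *m B *m (B^T *m P *m (Q *m C^T)) = C *m Q *m C^T.
  by rewrite !mulmxA -(mulmxA C B) mulmxK.
have XA : B^T *m P *m (Q *m C^T) *m (C *m B) = B^T *m P *m B.
  by rewrite !mulmxA -(mulmxA _ C^T C) mulmxKV.
split.
- by rewrite AX !mulmxA -(mulmxA _ C^T C) mulmxKV.
- by rewrite XA !mulmxA -(mulmxA _ B B^T) mulmxKV.
- by rewrite AX !trmx_mul trmxK symC mulmxA.
- by rewrite XA !trmx_mul trmxK symB mulmxA.
Qed.

Lemma mpinvP m n (A : 'M[R]_(m, n)) : is_mpinv A (mpinv A).
Proof.
have := full_rank_mpinv (col_base_full A) (row_base_free A).
by rewrite mulmx_base.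
Qed.

Lemma is_mpinv_uniq m n (A : 'M[R]_(m, n)) X Y :
  is_mpinv A X -> is_mpinv A Y -> X = Y.
Proof.
move=> [a1 a2 a3 a4] [b1 b2 b3 b4].
have eqAX : A *m X = A *m Y.
  have h : (A *m Y) *m (A *m X) = A *m X by rewrite mulmxA b1.
  by rewrite -a3 -h trmx_mul a3 b3 mulmxA a1.
have eqXA : X *m A = Y *m A.
  have h : (X *m A) *m (Y *m A) = X *m A by rewrite -mulmxA (mulmxA A) b1.
  by rewrite -a4 -h trmx_mul a4 b4 -mulmxA (mulmxA A) a1.
by rewrite -a2 eqXA -mulmxA eqAX mulmxA b2.
Qed.

End MoorePenrose.

Section Graph.
Variables (n : nat) (e : rel 'I_n).

Definition simple_graph : Prop := symmetric e /\ irreflexive e.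

Definition connected_graph : Prop := forall i j, connect e i j.

Definition degree (i : 'I_n) : nat := #|[set j | e i j]|.

Definition regular_graph (r : nat) : Prop := forall i, degree i = r.

(* In 'I_(n + n), lshift n i is v_i and rshift n i is its copy v_i'; the mixed
   cases say that v_j is in N(v_i) when v_i' and v_j are joined. *)
Definition double_graph : rel 'I_(n + n) := fun x y =>
  match split x, split y with
  | inl i, inl j => e i j
  | inr i, inr j => e i j
  | inr i, inl j => e i j
  | inl i, inr j => e j i
  end.

Variable R : realFieldType.

Definition adjacency_mx : 'M[R]_n := \matrix_(i, j) (e i j)%:R.

Definition degree_mx : 'M[R]_n := diag_mx (\row_i (degree i)%:R).

Definition laplacian_mx : 'M[R]_n := degree_mx - adjacency_mx.

Definition resistance_mx : 'M[R]_n :=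
  let X := mpinv laplacian_mx in
  \matrix_(i, j) (X i i + X j j - 2 * X i j).

Definition resistance_regular (k : R) : Prop :=
  forall i, \sum_j resistance_mx i j = k.

End Graph.

(* s lists the eigenvalues of A with algebraic multiplicity, in some order. *)
Definition is_spectrum (R : realFieldType) n (A : 'M[R]_n) (s : seq R) : Prop :=
  char_poly A = \prod_(x <- s) ('X - x%:P).

(* Main.v *)
Require Import Defs.
From mathcomp Require Import all_boot all_order all_algebra.
From mathcomp Require Import ring lra.

Set Implicit Arguments.
Unset Strict Implicit.
Unset Printing Implicit Defensive.

Import Order.TTheory GRing.Theory Num.Theory.
Local Open Scope ring_scope.

(** Write [L] for the Laplacian of the graph, [J] for the all-ones matrix and
    [S U V] for the block matrix with diagonal blocks [U + V] and off-diagonal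
    blocks [U - V] (the definition [twin_mx]).  On vectors of the form [(u, u)]
    this matrix acts as [2 U], on those of the form [(u, -u)] as [2 V]; hence
    such matrices multiply componentwise up to a factor 2, the characteristic
    polynomial of [S U V] is the product of those of [2 U] and [2 V], and
    [S (X / 4) (Y / 4)] is the Moore-Penrose inverse of [S U V] when [X] and
    [Y] are those of [U] and [V].

    For an [r]-regular graph the Laplacian of the double graph is [S L (r I)]
    (lemma [laplacian_double]).  Its Moore-Penrose inverse is therefore
    explicit, and the resistance matrix of the double graph is
    [S (M / 4 + J / (2 r)) (- I / (2 r))], with [M] the resistance matrix of
    the graph (lemma [resistance_double]).  Its spectrum consists of [- 1 / r],
    taken [n] times, and of the spectrum of [M / 2 + J / r].

    Since every row of [M] sums to [k], the all-ones vector is an eigenvector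
    of [M], and adding [J / r] to [M / 2] replaces one eigenvalue [k / 2] by
    [k / 2 + n / r] and keeps the others (lemma [char_poly_add_const_mx]).
    Finally [k] is the first entry of [rho]: it is an eigenvalue because [M] is
    symmetric, and the greatest one because the entries of [M] are nonnegative
    (lemma [eigenvalue_le_row_sum]), which follows from the Laplacian being
    positive semidefinite. *)

(** * Characteristic polynomials *)

Lemma det_block_sym (R : comNzRingType) n (A B : 'M[R]_n) :
  \det (block_mx A B B A) = \det (A + B) * \det (A - B).
Proof.
have h : block_mx 1%:M 0 (- 1%:M) 1%:M *m block_mx A B B A
         *m block_mx 1%:M 0 1%:M 1%:M = block_mx (A + B) B 0 (A - B).
  rewrite !mulmx_block !(mul1mx, mulmx1, mulmx0, mul0mx, addr0, add0r, mulNmx).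
  by congr block_mx; [rewrite addrA addrK addNr | rewrite addrC].
have := congr1 (fun M => \det M) h.
by rewrite !det_mulmx !det_lblock det_ublock !det1 !mulr1 !mul1r.
Qed.

(** The eigenvalues of [block_mx A B B A] are those of [A + B] and of
    [A - B]. *)
Lemma char_poly_block_sym (R : comNzRingType) n (A B : 'M[R]_n) :
  char_poly (block_mx A B B A) = char_poly (A + B) * char_poly (A - B).
Proof.
rewrite /char_poly /char_poly_mx map_block_mx scalar_mx_block.
rewrite opp_block_mx add_block_mx !add0r det_block_sym map_mxD map_mxB.
by rewrite !opprD !opprK !addrA.
Qed.

(** Both sides are [a] times the determinant of the matrix [M] bordered by a
    first row [1, c, ..., c] and a first column of ones.  Clearing the first
    column by row operations leaves [M - const_mx c]; replacing the first
    column by [a] times itself minus the sum of the others leaves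
    [a - n%:R * c] above zeros. *)
Lemma det_sub_const_mx (R : comNzRingType) n (M : 'M[R]_n) (a c : R) :
  M *m const_mx 1 = a *: (const_mx 1 : 'cV_n) ->
  \det (M - const_mx c) * a = (a - n%:R * c) * \det M.
Proof.
move=> hM.
pose b : 'cV[R]_n := const_mx 1; pose d : 'rV[R]_n := const_mx c.
pose B := block_mx (1%:M : 'M_1) d b M.
have detB : \det B = \det (M - const_mx c).
  have -> : B = block_mx 1%:M 0 b 1%:M *m block_mx 1%:M d 0 (M - const_mx c).
    rewrite mulmx_block !(mul1mx, mulmx1, mulmx0, mul0mx, addr0, add0r).
    congr block_mx.
    by apply/matrixP => i j; rewrite !mxE big_ord1 !mxE mul1r addrC subrK.
  by rewrite det_mulmx det_lblock det_ublock !det1 !mul1r.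
rewrite -detB.
have h : B *m block_mx a%:M 0 (- b) 1%:M = block_mx (a - n%:R * c)%:M d 0 M.
  rewrite mulmx_block !(mul1mx, mulmx1, mulmx0, mul0mx, addr0, add0r).
  congr block_mx.
    apply/matrixP => i j; rewrite !ord1 !mxE /= !mulr1n.
    under eq_bigr => l _ do rewrite !mxE mulrN1.
    by rewrite sumr_const card_ord mulNrn mulr_natl.
  by rewrite mulmxN hM scalar_mxC mul_scalar_mx subrr.
have := congr1 (fun M => \det M) h.
by rewrite det_mulmx det_lblock det_ublock det1 !det_scalar1 mulr1.
Qed.

(** Adding a multiple of the all-ones matrix moves only the eigenvalue [a] of
    the all-ones vector. *)
Lemma char_poly_add_const_mx (R : comNzRingType) n (A : 'M[R]_n) (a c : R) :
  A *m const_mx 1 = a *: (const_mx 1 : 'cV_n) ->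
  char_poly (A + const_mx c) * ('X - a%:P)
    = ('X - (a + n%:R * c)%:P) * char_poly A.
Proof.
move=> hA; rewrite /char_poly.
have -> : char_poly_mx (A + const_mx c) = char_poly_mx A - const_mx c%:P.
  by rewrite /char_poly_mx map_mxD map_const_mx opprD addrA.
rewrite det_sub_const_mx.
  by rewrite polyCD polyCM opprD addrA polyC_natr.
rewrite /char_poly_mx mulmxBl mul_scalar_mx scalerBl; congr (_ - _).
have -> : const_mx 1 = map_mx polyC (const_mx 1 : 'cV[R]_n).
  by rewrite map_const_mx.
by rewrite -map_mxM hA map_mxZ.
Qed.

Lemma size_spectrum (R : realFieldType) n (A : 'M[R]_n) (s : seq R) :
  is_spectrum A s -> size s = n.
Proof.
move=> /(congr1 (fun p : {poly R} => (size p).-1)).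
by rewrite size_char_poly size_prod_XsubC.
Qed.

Lemma is_spectrumZ (R : realFieldType) n (A : 'M[R]_n) (s : seq R) (a : R) :
  a != 0 -> is_spectrum A s -> is_spectrum (a *: A) [seq a * x | x <- s].
Proof.
move=> a0 hs; have sz := size_spectrum hs; rewrite /is_spectrum.
have -> : char_poly (a *: A) = a%:P ^+ n * (char_poly A \Po (a^-1 *: 'X)).
  rewrite /char_poly -[_ \Po _]/(comp_poly (a^-1 *: 'X) (\det (char_poly_mx A))).
  rewrite -det_map_mx -detZ; congr (\det _).
  apply/matrixP => i j; rewrite !mxE.
  rewrite raddfB raddfMn /= comp_polyX comp_polyC mulrBr polyCM mulrnAr.
  by rewrite -mul_polyC mulrA -(polyCM a a^-1) divff // mul1r.
rewrite hs big_map -[_ \Po _]/(comp_poly (a^-1 *: 'X) _) rmorph_prod /=.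
rewrite -{}sz; elim: s {hs} => [|x s IH].
  by rewrite !big_nil mulr1.
rewrite !big_cons -IH exprS mulrACA; congr (_ * _).
rewrite raddfB /= comp_polyX comp_polyC mulrBr polyCM.
by rewrite -mul_polyC mulrA -(polyCM a a^-1) divff // mul1r.
Qed.

(** * Moore-Penrose inverses and doubled matrices *)

Lemma is_mpinv_sym (R : realFieldType) n (A X : 'M[R]_n) :
  A^T = A -> is_mpinv A X -> X^T = X.
Proof.
move=> sA mpX; have [h1 h2 h3 h4] := mpX.
have hl : A *m X^T = X *m A by rewrite -h4 trmx_mul sA.
have hr : X^T *m A = A *m X by rewrite -h3 trmx_mul sA.
apply: (@is_mpinv_uniq _ _ _ A) mpX; split.
- by have := congr1 trmx h1; rewrite !trmx_mul sA mulmxA.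
- by have := congr1 trmx h2; rewrite !trmx_mul sA mulmxA.
- by rewrite hl h4.
- by rewrite hr h3.
Qed.

(** The matrix acting on column vectors with two equal halves as [2 U], and on
    those with two opposite halves as [2 V].  Omitting a factor 1/2 keeps the
    entries free of denominators. *)
Definition twin_mx (R : realFieldType) n (U V : 'M[R]_n) : 'M[R]_(n + n) :=
  block_mx (U + V) (U - V) (U - V) (U + V).

Lemma mul_twin_mx (R : realFieldType) n (U V U' V' : 'M[R]_n) :
  twin_mx U V *m twin_mx U' V' = twin_mx (2 *: (U *m U')) (2 *: (V *m V')).
Proof.
rewrite /twin_mx mulmx_block !(mulmxDl, mulmxDr, mulmxBl, mulmxBr, mulNmx, mulmxN).
by congr block_mx; apply/matrixP => i j; rewrite !mxE; lra.
Qed.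

Lemma tr_twin_mx (R : realFieldType) n (U V : 'M[R]_n) :
  (twin_mx U V)^T = twin_mx U^T V^T.
Proof. by rewrite /twin_mx tr_block_mx !linearD /= !linearN. Qed.

Lemma char_poly_twin_mx (R : realFieldType) n (U V : 'M[R]_n) :
  char_poly (twin_mx U V) = char_poly (2 *: U) * char_poly (2 *: V).
Proof.
have -> : 2 *: U = (U + V) + (U - V) by apply/matrixP => i j; rewrite !mxE; lra.
have -> : 2 *: V = (U + V) - (U - V) by apply/matrixP => i j; rewrite !mxE; lra.
exact: char_poly_block_sym.
Qed.

Lemma is_mpinv_twin_mx (R : realFieldType) n (U V X Y : 'M[R]_n) :
  is_mpinv U X -> is_mpinv V Y ->
  is_mpinv (twin_mx U V) (twin_mx (4^-1 *: X) (4^-1 *: Y)).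
Proof.
move=> [u1 u2 u3 u4] [v1 v2 v3 v4].
have h4 : 4 != 0 :> R by rewrite pnatr_eq0.
have half (M N : 'M[R]_n) : 2 *: (M *m (4^-1 *: N)) = 2^-1 *: (M *m N).
  by rewrite -scalemxAr scalerA; congr (_ *: _); lra.
have half' (M N : 'M[R]_n) : 2 *: ((4^-1 *: M) *m N) = 2^-1 *: (M *m N).
  by rewrite -scalemxAl scalerA; congr (_ *: _); lra.
have two (M N : 'M[R]_n) : 2 *: ((2^-1 *: M) *m N) = M *m N.
  by rewrite -scalemxAl scalerA divff ?pnatr_eq0 // scale1r.
split; rewrite !mul_twin_mx ?tr_twin_mx.
- by rewrite !half !two u1 v1.
- rewrite !half' !half -!scalemxAl u2 v2 !scalerA.
  by have -> : 2^-1 * 2^-1 = 4^-1 :> R by lra.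
- by rewrite !half !linearZ /= u3 v3.
- by rewrite !half' !linearZ /= u4 v4.
Qed.

Lemma char_poly_scalar_mx (R : comNzRingType) n (c : R) :
  char_poly (c%:M : 'M_n) = ('X - c%:P) ^+ n.
Proof.
by rewrite /char_poly /char_poly_mx map_scalar_mx -raddfB det_scalar.
Qed.

(** * Laplacian and resistance matrix of a graph *)

Lemma degreeE (R : realFieldType) n (e : rel 'I_n) i : (degree e i)%:R = \sum_j (e i j)%:R :> R.
Proof.
rewrite /degree cardsE -sum1_card natr_sum big_mkcond /=.
by apply: eq_bigr => j _; rewrite unfold_in; case: (e i j).
Qed.

Lemma laplacianE (R : realFieldType) n (e : rel 'I_n) i j :
  laplacian_mx e R i j = (\sum_l (e i l)%:R) *+ (i == j) - (e i j)%:R.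
Proof. by rewrite !mxE degreeE. Qed.

Section Graphs.
Variables (R : realFieldType) (n : nat) (e : rel 'I_n).

Lemma laplacian_sym : symmetric e -> (laplacian_mx e R)^T = laplacian_mx e R.
Proof.
move=> se; apply/matrixP => i j; rewrite mxE !laplacianE eq_sym se.
by case: eqP => [->|].
Qed.

(** The quadratic form of the Laplacian is half the sum of
    [(u 0 i - u 0 j) ^+ 2] over the ordered pairs of adjacent vertices. *)
Lemma laplacian_psd (u : 'rV[R]_n) :
  symmetric e -> 0 <= (u *m laplacian_mx e R *m u^T) 0 0.
Proof.
move=> se; set q := (X in 0 <= X).
pose S := \sum_i \sum_j (e i j)%:R * u 0 i ^+ 2.
pose T := \sum_i \sum_j (e i j)%:R * (u 0 i * u 0 j).
have S' : \sum_i \sum_j (e i j)%:R * u 0 j ^+ 2 = S.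
  rewrite exchange_big; apply: eq_bigr => i _; apply: eq_bigr => j _.
  by rewrite se.
have qE : q = S - T.
  rewrite /q !mxE /S /T -sumrB; apply: eq_bigr => j _.
  rewrite !mxE mulr_suml; under eq_bigr => i _ do rewrite laplacianE mulrBr mulrBl.
  rewrite sumrB (bigD1 j) //= eqxx mulr1n [X in _ + X - _]big1 ?addr0 => [|i]; last first.
    by move/negPf->; rewrite mulr0n mulr0 mul0r.
  congr (_ - _); first by rewrite mulrAC -expr2 mulrC mulr_suml.
  by apply: eq_bigr => i _; rewrite se; ring.
have : 0 <= \sum_i \sum_j (e i j)%:R * (u 0 i - u 0 j) ^+ 2.
  by apply: sumr_ge0 => i _; apply: sumr_ge0 => j _; rewrite mulr_ge0 ?sqr_ge0.
have -> : \sum_i \sum_j (e i j)%:R * (u 0 i - u 0 j) ^+ 2 = S + S - 2 * T.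
  rewrite -{2}S' /S /T mulr_sumr -big_split -sumrB; apply: eq_bigr => i _ /=.
  rewrite mulr_sumr -big_split -sumrB; apply: eq_bigr => j _ /=; ring.
by rewrite qE; lra.
Qed.

(** With [X] the Moore-Penrose inverse of the Laplacian [L] and [u] the
    difference of two unit vectors, the resistance is the value at [u] of the
    quadratic form of [X = X *m L *m X], that is, the value at [u *m X] of the
    quadratic form of [L]. *)
Lemma resistance_ge0 i j : symmetric e -> 0 <= resistance_mx e R i j.
Proof.
move=> se; rewrite /resistance_mx mxE /=.
have mpX := mpinvP (laplacian_mx e R); move: (mpinv _) mpX => X mpX.
have sX := is_mpinv_sym (laplacian_sym se) mpX; have [_ h2 _ _] := mpX.
pose u : 'rV[R]_n := delta_mx 0 i - delta_mx 0 j.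
have := laplacian_psd (u *m X) se.
have -> : u *m X *m laplacian_mx e R *m (u *m X)^T = u *m X *m u^T.
  by rewrite trmx_mul sX !mulmxA -2!(mulmxA u) h2.
have -> : (u *m X *m u^T) 0 0 = X i i + X j j - 2 * X i j; last by [].
rewrite /u mulmxBl -!rowE linearB /= !trmx_delta mulmxBr -!colE !mxE.
by have := congr1 (fun M : 'M_n => M i j) sX; rewrite mxE => ->; ring.
Qed.

Lemma resistance_sym : symmetric e -> (resistance_mx e R)^T = resistance_mx e R.
Proof.
move=> se; rewrite /resistance_mx.
have mpX := mpinvP (laplacian_mx e R); move: (mpinv _) mpX => X mpX.
have sX := is_mpinv_sym (laplacian_sym se) mpX.
apply/matrixP => i j; rewrite !mxE (addrC (X i i)).
by have := congr1 (fun M : 'M_n => M i j) sX; rewrite mxE => ->.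
Qed.

(** * The double graph *)

Lemma laplacian_double r : symmetric e -> regular_graph e r ->
  laplacian_mx (double_graph e) R = twin_mx (laplacian_mx e R) r%:R%:M.
Proof.
move=> se dr.
have sumr i : \sum_j (e i j)%:R = r%:R :> R by rewrite -degreeE dr.
have sL (i : 'I_n) : split (lshift n i) = inl i by exact: (unsplitK (inl i)).
have sR (i : 'I_n) : split (rshift n i) = inr i by exact: (unsplitK (inr i)).
have sumD x : \sum_y (double_graph e x y)%:R = r%:R + r%:R :> R.
  rewrite big_split_ord /= /double_graph.
  under eq_bigr do rewrite sL; under [X in _ + X]eq_bigr do rewrite sR.
  case: split => i; rewrite ?sumr //; congr (_ + _) => //.
  by under eq_bigr do rewrite se; rewrite sumr.
apply/matrixP => x y; rewrite laplacianE sumD -[x]splitK -[y]splitK.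
case: (split x) (split y) => i [] j /=.
- rewrite block_mxEul mxE laplacianE sumr !mxE /double_graph !sL eq_lshift.
  by rewrite mulrnDl addrAC.
- rewrite block_mxEur mxE laplacianE sumr !mxE /double_graph sL sR eq_lrshift.
  by rewrite mulr0n addrAC subrr se.
- rewrite block_mxEdl mxE laplacianE sumr !mxE /double_graph sL sR eq_rlshift.
  by rewrite mulr0n addrAC subrr.
- rewrite block_mxEdr mxE laplacianE sumr !mxE /double_graph !sR eq_rshift.
  by rewrite mulrnDl addrAC.
Qed.

Lemma resistance_double r : (0 < r)%N -> symmetric e -> regular_graph e r ->
  resistance_mx (double_graph e) R =
    twin_mx (4^-1 *: resistance_mx e R + const_mx (2 * r%:R)^-1)
            (- (2 * r%:R)^-1)%:M.
Proof.
move=> r0 se dr; have rn0 : r%:R != 0 :> R by rewrite pnatr_eq0 -lt0n.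
have mpr : is_mpinv (r%:R%:M : 'M[R]_n) r%:R^-1%:M.
  by split; rewrite -!scalar_mxM ?tr_scalar_mx // ?(mulfV rn0) ?(mulVf rn0) mul1r.
have mpX := mpinvP (laplacian_mx e R).
have mpD := is_mpinv_twin_mx mpX mpr.
have mpD' := mpinvP (laplacian_mx (double_graph e) R).
rewrite -laplacian_double // in mpD.
rewrite /resistance_mx (is_mpinv_uniq mpD' mpD) {mpD mpD'}.
have sX := is_mpinv_sym (laplacian_sym se) mpX.
move: (mpinv _) sX {mpX mpr} => X sX.
have -> : (2 * r%:R)^-1 = r%:R^-1 / 2 :> R by rewrite invfM mulrC.
move: (r%:R^-1) => c.
apply/matrixP => x y; rewrite -[x]splitK -[y]splitK.
case: (split x) (split y) => i [] j /=;
  rewrite [LHS]mxE /twin_mx !(block_mxEul, block_mxEur, block_mxEdl, block_mxEdr);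
  rewrite !mxE !eqxx !mulr1n; case: (i == j); rewrite ?mulr1n ?mulr0n; lra.
Qed.

End Graphs.

(** * The greatest eigenvalue *)

(** The easy half of the Perron-Frobenius theorem, by comparing the 1-norms of
    [v] and [v *m A] for a left eigenvector [v]. *)
Lemma eigenvalue_le_row_sum (R : realFieldType) n (A : 'M[R]_n) (k x : R) :
  (forall i j, 0 <= A i j) -> (forall i, \sum_j A i j = k) ->
  root (char_poly A) x -> x <= k.
Proof.
move=> A0 Ak; rewrite -eigenvalue_root_char => /eigenvalueP[v vA v0].
pose N := \sum_i `|v 0 i|.
have N0 : 0 < N.
  rewrite lt_def sumr_ge0 // andbT; apply: contraNneq v0 => /eqP.
  rewrite psumr_eq0 // => /allP h; apply/eqP/rowP => i; rewrite mxE.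
  by apply/eqP; rewrite -normr_eq0; apply: h; rewrite mem_index_enum.
rewrite -(ler_pM2r N0) (le_trans (ler_norm _)) //.
rewrite normrM (gtr0_norm N0) /N !mulr_sumr.
have -> : \sum_i k * `|v 0 i| = \sum_j \sum_i `|v 0 i| * A i j.
  by rewrite exchange_big; apply: eq_bigr => i _; rewrite -mulr_sumr Ak mulrC.
apply: ler_sum => j _; rewrite -normrM.
have := congr1 (fun w : 'rV_n => w 0 j) vA; rewrite !mxE => <-.
apply: (le_trans (ler_norm_sum _ _ _)); apply: ler_sum => i _.
by rewrite normrM (ger0_norm (A0 _ _)).
Qed.

Lemma root_char_poly_row_sum (R : realFieldType) n (A : 'M[R]_n) (k : R) :
  (0 < n)%N -> A^T = A -> (forall i, \sum_j A i j = k) ->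
  root (char_poly A) k.
Proof.
move=> n0 sA Ak; rewrite -eigenvalue_root_char; apply/eigenvalueP.
exists (const_mx 1).
  apply/rowP => j; rewrite !mxE mulr1 -(Ak j); apply: eq_bigr => i _.
  by rewrite -{1}sA !mxE mul1r.
by apply/eqP => /rowP/(_ (Ordinal n0))/eqP; rewrite !mxE oner_eq0.
Qed.

Lemma regular_connected_gt0 n (e : rel 'I_n) r : (2 <= n)%N ->
  connected_graph e -> regular_graph e r -> (0 < r)%N.
Proof.
move=> n2 ce re; have n0 := ltnW n2.
have /connectP[[|x p] /=] := ce (Ordinal n0) (Ordinal n2).
  by move=> _ /(congr1 val).
by case/andP=> ex _ _; rewrite -(re (Ordinal n0)); apply/card_gt0P; exists x; rewrite inE.
Qed.

Theorem theorem5p1 (R : rcfType) (n : nat) (e : rel 'I_n) (r : nat) (k : R)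
    (rho : n.-tuple R) :
  (2 <= n)%N ->
  simple_graph e ->
  connected_graph e ->
  regular_graph e r ->
  resistance_regular e k ->
  is_spectrum (resistance_mx e R) rho ->
  sorted >=%R rho ->
  is_spectrum (resistance_mx (double_graph e) R)
    ((rho`_0 / 2 + n%:R / r%:R)
       :: [seq x / 2 | x <- behead rho] ++ nseq n (- (1 / r%:R))).
Proof.
move=> n2 [se _] ce re ke spec srt.
have n0 := ltnW n2; have r0 := regular_connected_gt0 n2 ce re.
have rootE x : root (char_poly (resistance_mx e R)) x = (x \in tval rho).
  by rewrite spec root_prod_XsubC.
have kin : k \in tval rho.
  by rewrite -rootE root_char_poly_row_sum ?resistance_sym.
have kmax x : x \in tval rho -> x <= k.
  rewrite -rootE; apply: eigenvalue_le_row_sum ke => i j.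
  exact: resistance_ge0.
have {rootE} := is_spectrumZ (_ : 2^-1 != 0) spec.
rewrite invr_eq0 pnatr_eq0 => /(_ isT).
(* The head of the decreasing list rho is its greatest element, hence k. *)
case: rho spec srt kin kmax => -[|x s] /= _ _; first by [].
rewrite inE => srt kin kmax spec.
have xk : x = k.
  apply/le_anti; rewrite kmax ?mem_head //=.
  case/orP: kin => [/eqP -> //|]; move: k {kmax ke spec}; apply/allP.
  by apply: order_path_min srt => a b c; exact: (fun h1 h2 => le_trans h2 h1).
rewrite {}xk in spec *.
have rn0 : r%:R != 0 :> R by rewrite pnatr_eq0 -lt0n.
rewrite /is_spectrum (resistance_double _ r0 se re) char_poly_twin_mx.
rewrite scalerDr scalerA scale_scalar_mx char_poly_scalar_mx.
have -> : 2 * 4^-1 = 2^-1 :> R by lra.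
have -> : 2 * - (2 * r%:R)^-1 = - (1 / r%:R) :> R by field.
have -> : 2 *: const_mx (2 * r%:R)^-1 = const_mx r%:R^-1 :> 'M[R]_n.
  by apply/matrixP => i j; rewrite !mxE; field.
rewrite big_cons big_cat /= big_nseq mulrA; congr (_ * _); last first.
  by rewrite iter_mulr_1.
have kn0 : 'X - (2^-1 * k)%:P != 0 :> {poly R} by rewrite polyXsubC_eq0.
(* The factor 'X - k / 2 is restored on both sides, where it completes the
   characteristic polynomial of half the resistance matrix on the right. *)
apply: (mulIf kn0); rewrite char_poly_add_const_mx.
  rewrite spec big_cons mulrA mulrAC; congr (_ * _ * _).
    by rewrite mulrC.
  by rewrite !big_map; apply: eq_bigr => i _; rewrite mulrC.
apply/matrixP => i j; rewrite -scalemxAl mxE [in RHS]mxE [X in _ = _ * X]mxE mulr1.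
rewrite -(ke i) [in LHS]mxE; congr (_ * _).
by apply: eq_bigr => l _; rewrite [const_mx _ _ _]mxE mulr1.
Qed.
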